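(* For $n\ge 9$, $F(G_{3,3}^{(n)}) < F(R_{n-4,1}) < F(G_{3,2}^{(n)})$.
   Context: All graphs are finite and simple. The F-index of a graph $G$ is $F(G)=\sum_{v\in V(G)} d_G(v)^3$. Attaching a leaf to a vertex means adding a new vertex adjacent only to it. $G_{3,2}^{(n)}$ is obtained from a triangle by attaching $n-4$ leaves to one vertex $u$ and one leaf to another vertex of the triangle. $G_{3,3}^{(n)}$ is obtained from a triangle $xyz$ by attaching $n-5$ leaves to $x$ and $2$ leaves to $y$. $R_{k,1}$ ($k\ge1$) is obtained from a triangle $xyz$ by attaching $k$ pendant vertices to $z$ and then attaching one new leaf to one of these pendant vertices; it has $k+4$ vertices. *)

(* Defs.v *)
From mathcomp Require Import all_boot.

Set Implicit Arguments.
Unset Strict Implicit.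
Unset Printing Implicit Defensive.

Record sgraph := SGraph {
  vertex :> finType;
  adj : rel vertex;
  adj_sym : symmetric adj;
  adj_irr : irreflexive adj }.

Definition degree (G : sgraph) (v : G) : nat := #|[set w | adj v w]|.

Definition F_index (G : sgraph) : nat := \sum_(v : G) degree v ^ 3.

Section AttachLeaves.
Variables (G : sgraph) (v : G) (k : nat).

(* [inl] injects the vertices of G; the k vertices [inr i] are new. *)
Definition attach_rel : rel (G + 'I_k) := fun a b =>
  match a, b with
  | inl x, inl y => adj x y
  | inl x, inr _ => x == v
  | inr _, inl y => y == v
  | inr _, inr _ => false
  end.

Lemma attach_rel_sym : symmetric attach_rel.
Proof. by case=> [x|i] [y|j] //=; rewrite adj_sym. Qed.

Lemma attach_rel_irr : irreflexive attach_rel.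
Proof. by case=> [x|i] //=; rewrite adj_irr. Qed.

Definition attach_leaves : sgraph := SGraph attach_rel_sym attach_rel_irr.

Definition old_vertex (x : G) : attach_leaves := inl x.

Definition leaf (i : 'I_k) : attach_leaves := inr i.

End AttachLeaves.

Lemma neq_sym (T : eqType) : symmetric (fun x y : T => x != y).
Proof. by move=> x y; rewrite eq_sym. Qed.

Lemma neq_irr (T : eqType) : irreflexive (fun x y : T => x != y).
Proof. by move=> x; rewrite eqxx. Qed.

Definition triangle : sgraph := SGraph (@neq_sym 'I_3) (@neq_irr 'I_3).

Definition tri_x : triangle := @Ordinal 3 0 isT.
Definition tri_y : triangle := @Ordinal 3 1 isT.
Definition tri_z : triangle := @Ordinal 3 2 isT.

(* Subtraction is truncated: G_{3,2}^(n) has n vertices only for n >= 4, and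
   G_{3,3}^(n) only for n >= 5. *)
Definition G32 (n : nat) : sgraph :=
  attach_leaves (old_vertex tri_x (n - 4) tri_y) 1.

Definition G33 (n : nat) : sgraph :=
  attach_leaves (old_vertex tri_x (n - 5) tri_y) 2.

(* R_{k,1}, where i selects the pendant vertex that receives the extra leaf
   (so that k >= 1); the choice is immaterial up to isomorphism. *)
Definition R1 (k : nat) (i : 'I_k) : sgraph :=
  attach_leaves (leaf tri_z i) 1.

(* Main.v *)
Require Import Defs.
From mathcomp Require Import all_boot.
From mathcomp Require Import zify.

(** Attaching [k] leaves to a vertex [v] of degree [d] raises the degree of
    [v] to [d + k], keeps the other old degrees and creates [k] vertices of
    degree 1, so the F-index grows by [(d + k)^3 - d^3 + k].  With [m = n - 4]
    the three indices are [(m + 1)^3 + m + 73], [(m + 2)^3 + m + 24] and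
    [(m + 2)^3 + m + 36]. *)

Lemma degreeE (G : sgraph) (v : G) : degree v = \sum_(w : G) adj v w.
Proof.
rewrite /degree cardsE -sum1_card big_mkcond.
by apply: eq_bigr => w _; rewrite -topredE /=; case: (adj v w).
Qed.

Lemma degree_old_vertex (G : sgraph) (v : G) (k : nat) (x : G) :
  degree (old_vertex v k x) = degree x + (x == v) * k.
Proof.
rewrite !degreeE big_sumType /=.
by rewrite sum_nat_const card_ord mulnC.
Qed.

Lemma degree_leaf (G : sgraph) (v : G) (k : nat) (i : 'I_k) :
  degree (leaf v i) = 1.
Proof.
rewrite degreeE big_sumType /= [X in _ + X]big1 // addn0.
by rewrite (bigD1 v) //= eqxx big1 // => x /negPf->.
Qed.

(** The old cube stands on the left to avoid truncated subtraction. *)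
Lemma F_index_attach_leaves (G : sgraph) (v : G) (k : nat) :
  F_index (attach_leaves v k) + degree v ^ 3
    = F_index G + (degree v + k) ^ 3 + k.
Proof.
rewrite /F_index big_sumType /=.
rewrite [X in _ + X + _](eq_bigr (fun=> 1)); last first.
  by move=> i _; rewrite (degree_leaf G v k i).
(* Only the term of [v] differs between the two sums over old vertices. *)
rewrite sum1_card card_ord (bigD1 v) //= [in RHS](bigD1 v) //=.
rewrite (degree_old_vertex G v k v) eqxx mul1n.
rewrite (eq_bigr (fun x : G => degree x ^ 3)); first by lia.
by move=> x /negPf nxv; rewrite (degree_old_vertex G v k x) nxv addn0.
Qed.

Lemma degree_triangle (x : triangle) : degree x = 2.
Proof. by rewrite degreeE !big_ord_recl big_ord0; case: x => [[|[|[]]]]. Qed.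

Lemma F_index_triangle : F_index triangle = 24.
Proof.
rewrite /F_index (eq_bigr (fun=> 8)) => [|x _]; last by rewrite degree_triangle.
by rewrite sum_nat_const card_ord.
Qed.

Lemma F_index_triangle_leaves (v : triangle) (k : nat) :
  F_index (attach_leaves v k) = 16 + (k + 2) ^ 3 + k.
Proof.
have := F_index_attach_leaves triangle v k.
by rewrite degree_triangle F_index_triangle; lia.
Qed.

(** Since [w] differs from [v], it still has degree 2 before the second attachment; the third corner
    contributes the 8. *)
Lemma F_index_triangle_leaves2 (v w : triangle) (k l : nat) :
  w != v ->
  F_index (attach_leaves (old_vertex v k w) l)
    = 8 + (k + 2) ^ 3 + k + (l + 2) ^ 3 + l.
Proof.
move=> /negPf nwv; have := F_index_attach_leaves _ (old_vertex v k w) l.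
by rewrite degree_old_vertex nwv degree_triangle F_index_triangle_leaves; lia.
Qed.

(** The chosen pendant vertex goes from degree 1 to 2, a net gain of [2^3 - 1 + 1 = 8]. *)
Lemma F_index_R1 (k : nat) (i : 'I_k) : F_index (R1 i) = 24 + (k + 2) ^ 3 + k.
Proof.
have := F_index_attach_leaves _ (leaf tri_z i) 1.
by rewrite degree_leaf F_index_triangle_leaves -/(R1 i); lia.
Qed.

Theorem theorem8 (n : nat) (hn : 9 <= n) (i : 'I_(n - 4)) :
  F_index (G33 n) < F_index (R1 i) /\ F_index (R1 i) < F_index (G32 n).
Proof.
rewrite F_index_R1 /G33 /G32 !F_index_triangle_leaves2 //.
have [m ->] : exists m, n = m + 9 by exists (n - 9); lia.
have -> : m + 9 - 4 = m + 5 by lia.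
have -> : m + 9 - 5 = m + 4 by lia.
(* With [m] now standing for [n - 9], the gaps are [3m^2 + 39m + 78] and 12. *)
split; nia.
Qed.
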